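(* Let $r\ge2$, let $\bm{\nu}=(\mu_1,\dots,\mu_{r-1})\in\mathcal{L}^{r-1}$ with $\mu_j\in\mathcal{L}_{N_j}$, $N_j\le\infty$, $\bm{K}=(N_1,\dots,N_{r-1})$, and suppose that $\bm{\nu}$ and $\widehat{\bm{\nu}}=(x-z_0)\bm{\nu}$ are perfect for some $z_0\in\mathbb{R}$. Let $1\le j\le r-1$ and let $\bm{k}$ be such that $\bm{k},\bm{k}-\bm{e}_j\in\mathbb{N}^{r-1}_{\bm{K}}$. If $\widehat A^{(j)}_{\bm{k}-\bm{e}_j}(x)\sim\widehat A^{(j)}_{\bm{k}}(x)$, then $A^{(j)}_{\bm{k}}(x)$ is real-rooted. Moreover, $$A^{(j)}_{\bm{k}}(x)\sim\widehat A^{(j)}_{\bm{k}}(x)\qquad\text{and}\qquad A^{(j)}_{\bm{k}}(x)\sim\widehat A^{(j)}_{\bm{k}-\bm{e}_j}(x).$$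
   Context: For two real polynomials, $p\sim q$ (the zeros interlace) means: all zeros of $p$ and $q$ are pairwise distinct, real and simple, and between every two consecutive zeros of one of the polynomials there lies exactly one zero of the other. A polynomial is real-rooted if all its zeros are real. $\mathbb{N}=\{0,1,2,\dots\}$; $\bm{e}_j$ are the standard unit vectors; $\mathbb{N}^s_{\bm{M}}=\{\bm{n}\in\mathbb{N}^s:n_j\le M_j\ \forall j\}$. A moment functional is a linear map $\mu:\mathbb{C}[x]\to\mathbb{C}$. Put $\Delta_n=\det(\mu[x^{i+k}])_{i,k=0}^{n-1}$. For $N\in\{1,2,\dots\}$, $\mathcal{L}_N$ is the set of $\mu$ with $\Delta_n\ne0$ for $1\le n\le N$ and $\Delta_n=0$ for $n>N$; $\mathcal{L}_\infty$ is the set of $\mu$ with $\Delta_n\neq0$ for all $n$; $\mathcal{L}=\mathcal{L}_\infty\cup\bigcup_{N\ge1}\mathcal{L}_N$. $(x-z_0)\bm{\nu}$ is the system of functionals $f\mapsto\mu_j[(x-z_0)f]$. For a system $(\mu_1,\dots,\mu_s)$ and $\bm{n}\in\mathbb{N}^s\setminus\{\bm{0}\}$, $|\bm{n}|=\sum n_j$, the index $\bm{n}$ is normal if there is a unique vector of polynomials $(A^{(1)}_{\bm{n}},\dots,A^{(s)}_{\bm{n}})$ with $\deg A^{(j)}_{\bm{n}}\le n_j-1$ ($A^{(j)}_{\bm n}=0$ if $n_j=0$), $\sum_j\mu_j[A^{(j)}_{\bm{n}}x^p]=0$ for $0\le p\le|\bm{n}|-2$ and $\sum_j\mu_j[A^{(j)}_{\bm{n}}x^{|\bm{n}|-1}]=1$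 (equivalently, every nonzero $P$ with $\deg P\le|\bm{n}|$ and $\mu_j[Px^p]=0$ for $0\le p\le n_j-1$, $1\le j\le s$, has degree exactly $|\bm{n}|$). The index $\bm{0}$ is always normal, with all $A^{(j)}_{\bm{0}}=0$. These type I multiple orthogonal polynomials are denoted $A^{(j)}_{\bm{n}}$ for $\bm{\nu}$ and $\widehat A^{(j)}_{\bm{n}}$ for $\widehat{\bm{\nu}}$. A system with $\mu_j\in\mathcal{L}_{N_j}$ is perfect if all indices $\bm{n}$ with $0\le n_j\le N_j$ for all $j$ are normal.
   Formalization: The polynomial A_k^(j) is additionally assumed to have real coefficients (as ∼ presupposes); for complex-valued functionals the claim fails without this, and Â_k, Â_{k−e_j} are assumed to be defined, i.e. these indices are normal for the system (x−z_0)ν. *)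

(* Defs.v *)
From HB Require Import structures.
From mathcomp Require Import all_boot all_order all_algebra.
From mathcomp Require Import reals complex.

Set Implicit Arguments.
Unset Strict Implicit.
Unset Printing Implicit Defensive.

Import Order.TTheory GRing.Theory Num.Theory.
Local Open Scope ring_scope.
Local Open Scope complex_scope.

Section RealPolynomials.
Variable R : realType.
Implicit Types p q : {poly R}.

Definition complexify p : {poly R[i]} := map_poly (real_complex R) p.

(* Zeros range over the complex numbers; in particular 0 is not real-rooted. *)
Definition real_rooted p : Prop :=
  forall z : R[i], root (complexify p) z -> z \is Num.real.

Definition consecutive_zeros p (x y : R) : Prop :=
  [/\ root p x, root p y, x < y & forall t, x < t < y -> ~~ root p t].

Definition one_zero_between_zeros p q : Prop :=
  forall x y, consecutive_zeros p x y ->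
    exists! t : R, x < t < y /\ root q t.

Definition simple_zeros p : Prop := forall x : R, root p x -> mup x p = 1%N.

(* The relation p ~ q. Neither polynomial can be 0, since 0 is not real-rooted;
   nonzero constants are allowed and have no zeros. *)
Definition interlace p q : Prop :=
  [/\ real_rooted p /\ real_rooted q,
      simple_zeros p /\ simple_zeros q,
      forall x : R, ~~ (root p x && root q x),
      one_zero_between_zeros p q
    & one_zero_between_zeros q p].

End RealPolynomials.

Notation moment_functional R := {scalar {poly R[i]}}.

Section MomentFunctionals.
Variable R : realType.
Implicit Type mu : moment_functional R.

Definition hankel_det mu (n : nat) : R[i] :=
  \det (\matrix_(i < n, k < n) mu 'X^(i + k)).

(* mu is in L_N; None stands for N = oo. *)
Definition in_L (N : option nat) mu : Prop :=
  if N is Some M then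
    [/\ (0 < M)%N,
        forall n, (0 < n <= M)%N -> hankel_det mu n != 0
      & forall n, (M < n)%N -> hankel_det mu n = 0]
  else forall n, (0 < n)%N -> hankel_det mu n != 0.

(* The functional (x - z0) mu. *)
Definition christoffel (z0 : R) mu (f : {poly R[i]}) : R[i] :=
  mu (('X - (z0%:C)%:P) * f).

Fact christoffel_is_linear z0 mu : scalar (christoffel z0 mu).
Proof. by move=> a f g; rewrite /christoffel mulrDr -scalerAr linearP. Qed.

HB.instance Definition _ z0 mu :=
  GRing.isLinear.Build R[i] {poly R[i]} R[i] *%R (christoffel z0 mu)
    (christoffel_is_linear z0 mu).

End MomentFunctionals.

Section TypeI.
Variables (R : realType) (s : nat).

Definition multi_index := {ffun 'I_s -> nat}.
Definition fsystem := 'I_s -> moment_functional R.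

Implicit Types (n : multi_index) (nu : fsystem) (N : 'I_s -> option nat).

Definition midx_size n : nat := (\sum_j n j)%N.

(* n - e_j, meaningful only when 0 < n j because of truncated subtraction. *)
Definition midx_pred n (j : 'I_s) : multi_index :=
  [ffun i => (n i - (i == j))%N].

Definition in_box N n : Prop :=
  forall j, if N j is Some M then (n j <= M)%N else true.

Definition typeI_conditions nu n (A : {ffun 'I_s -> {poly R[i]}}) : Prop :=
  (forall j, (size (A j) <= n j)%N) /\
  ((0 < midx_size n)%N ->
    (forall p, (p.+2 <= midx_size n)%N -> \sum_j nu j (A j * 'X^p) = 0) /\
    \sum_j nu j (A j * 'X^((midx_size n).-1)) = 1).

(* A is the type I vector of nu at n; this entails that n is normal. *)
Definition is_typeI nu n A : Prop := unique (typeI_conditions nu n) A.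

Definition normal nu n : Prop := exists A, is_typeI nu n A.

(* The only N with in_L (N j) (nu j) for all j is determined by nu. For
   (x - z0) nu it may differ from that of nu: multiplication by x - z0 can lower
   a finite N j by one. *)
Definition perfect nu : Prop :=
  exists N, (forall j, in_L (N j) (nu j)) /\
            (forall n, in_box N n -> normal nu n).

Definition christoffel_system (z0 : R) nu : fsystem :=
  fun j => christoffel z0 (nu j).

End TypeI.

(* Main.v *)
(* For every p < |k| the vector A_k - Ahat_(k-e_j) is orthogonal to x^p with
   respect to (x - z0) nu, except at p = |k|-1, so normality gives
   A_k = Ahat_(k-e_j) + c Ahat_k, and c is real. As nu is normal at k and at k - e_j,
   A_k^(j) has exact degree k_j - 1, so c <> 0 and deg Ahat_(k-e_j)^(j) < deg Ahat_k^(j).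
   When p ~ q and deg p < deg q, all residues of p/q have the same sign; hence
   the Wronskian p'q - pq' = - sum_x (residue at x) (q/(X-x))^2 has no real zero, and
   p + a q has no zero off the real line, because Im (p/q) does not vanish there.
   The Wronskians of p + a q with q and with p are multiples of that of p and q, and
   a Wronskian without real zeros forces interlacing. *)
Require Import Defs.
From HB Require Import structures.
From mathcomp Require Import all_boot all_order all_algebra.
From mathcomp Require Import reals complex polyrcf ring.

Set Implicit Arguments.
Unset Strict Implicit.
Unset Printing Implicit Defensive.

Import Order.TTheory GRing.Theory Num.Theory.
Local Open Scope ring_scope.
Local Open Scope complex_scope.

Section Interlacing.
Variable R : realType.
Implicit Types (p q h : {poly R}) (x y t : R) (s : seq R).

(** * Simple zeros and sign changes of real polynomials *)

Lemma real_rooted_neq0 p : real_rooted p -> p != 0.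
Proof.
move=> rp; apply/eqP => p0; have := rp 'i.
by rewrite p0 /complexify rmorph0 root0 => /(_ isT); rewrite complex_real oner_eq0.
Qed.

Lemma deriv_XsubC_mul h x : (('X - x%:P) * h)^`().[x] = h.[x].
Proof. by rewrite derivM derivXsubC !hornerE subrr mul0r addr0. Qed.

Lemma mup_eq1 p x : root p x -> p != 0 -> (mup x p == 1%N) = (p^`().[x] != 0).
Proof.
case/factor_theorem=> h ->; rewrite mulrC mulf_eq0 negb_or => /andP[X0 h0].
rewrite deriv_XsubC_mul mupM // -[mup x ('X - _)]/(mup x (('X - x%:P) ^+ 1)).
rewrite mup_XsubCX eqxx add1n eqSS -[_.[x] == 0]/(root h x) -dvdp_XsubCl.
by rewrite XsubC_dvd // lt0n negbK.
Qed.

Lemma simple_zerosP p : p != 0 ->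
  simple_zeros p <-> forall x, root p x -> p^`().[x] != 0.
Proof.
move=> p0; split=> sp x px; first by rewrite -mup_eq1 //; apply/eqP/sp.
by apply/eqP; rewrite mup_eq1 // sp.
Qed.

(** Write [p = (X - x)(X - y) h]: then [h] keeps its sign on [x, y], and the two derivatives are
    [(x - y) h(x)] and [(y - x) h(y)]. *)
Lemma deriv_consecutive_zeros p x y : consecutive_zeros p x y ->
  p^`().[x] != 0 -> p^`().[y] != 0 -> p^`().[x] * p^`().[y] < 0.
Proof.
case=> px py xy nr.
have [h ph] : exists h, p = ('X - x%:P) * (('X - y%:P) * h).
  move: py; case/factor_theorem: px => h ->.
  rewrite rootM root_XsubC gt_eqF // orbF => /factor_theorem[h' ->].
  by exists h'; ring.
have dx : p^`().[x] = (x - y) * h.[x] by rewrite ph deriv_XsubC_mul !hornerE.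
have dy : p^`().[y] = (y - x) * h.[y].
  by rewrite ph mulrCA deriv_XsubC_mul !hornerE.
rewrite dx dy !mulf_eq0 !negb_or => /andP[_ hx] /andP[_ hy].
have : 0 < h.[x] * h.[y].
  apply: (@noroot_noivt _ h x y); rewrite ?in_itv /= ?lexx ?ltW // => t.
  rewrite in_itv /= !le_eqVlt => /andP[/orP[/eqP<-//|xt] /orP[/eqP->//|ty]].
  by apply: contra (nr t _) => [ht|]; rewrite ?xt // ph !rootM ht !orbT.
move=> h_gt0; have -> : (x - y) * h.[x] * ((y - x) * h.[y]) =
  - ((y - x) ^+ 2 * (h.[x] * h.[y])) by ring.
by rewrite oppr_lt0 mulr_gt0 // exprn_gt0 // subr_gt0.
Qed.

(** Dividing out the zero [t] leaves a cofactor [h] of constant sign on [x, y], while [X - t]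
    changes sign. *)
Lemma simple_zero_sign_change q x y : q != 0 -> simple_zeros q -> x < y ->
  ~~ root q x -> ~~ root q y -> (exists! t, x < t < y /\ root q t) ->
  q.[x] * q.[y] < 0.
Proof.
move=> q0 /(simple_zerosP q0) sq xy qx qy [t [[/andP[xt ty] qt] ut]].
have [h qh] : exists h, q = ('X - t%:P) * h.
  by case/factor_theorem: qt => h ->; exists h; rewrite mulrC.
have ht : ~~ root h t by have := sq _ qt; rewrite qh deriv_XsubC_mul.
have : 0 < h.[x] * h.[y].
  have hq u : root h u -> root q u by rewrite qh rootM orbC => ->.
  apply: (@noroot_noivt _ h x y); rewrite ?in_itv /= ?lexx ?ltW // => u.
  rewrite in_itv /= => /andP[xu uy].
  have [ux|xu'|->] := ltgtP u x; last exact: contra (@hq x) qx.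
    by move: xu; rewrite leNgt ux.
  have [yu|uy'|<-] := ltgtP y u; last exact: contra (@hq y) qy.
    by move: uy; rewrite leNgt yu.
  (* A zero of [h] in ]x, y[ is a zero of [q], hence equals [t]; but [h(t) = q'(t)] is nonzero by
     simplicity. *)
  by apply: contra ht => hu; rewrite (ut u) // xu' uy' hq.
move=> h_gt0; rewrite qh !hornerM !hornerXsubC.
have -> : (x - t) * h.[x] * ((y - t) * h.[y]) =
  - ((t - x) * (y - t) * (h.[x] * h.[y])) by ring.
by rewrite oppr_lt0 mulr_gt0 // mulr_gt0 ?subr_gt0.
Qed.

(** * Residues and partial fractions of [p / q] *)

Lemma real_rooted_split p : real_rooted p ->
  exists2 s, sorted <=%R s & p = lead_coef p *: \prod_(x <- s) ('X - x%:P).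
Proof.
move=> rp; have p0 := real_rooted_neq0 rp.
have [r pr] := closed_field_poly_normal (complexify p).
have rr z : z \in r -> z = (complex.Re z)%:C.
  move=> zr; rewrite RRe_real //; apply: rp.
  by rewrite pr rootZ ?root_prod_XsubC // lead_coef_eq0 map_poly_eq0.
exists (sort <=%R [seq complex.Re z | z <- r]); first exact/sort_sorted/le_total.
rewrite (perm_big [seq complex.Re z | z <- r]) ?perm_sort //=.
apply: (@map_poly_inj _ _ (real_complex R)).
rewrite [LHS]pr map_polyZ rmorph_prod /= big_map lead_coef_map; congr (_ *: _).
by apply: eq_big_seq => z /rr zE; rewrite map_polyXsubC /= -zE.
Qed.

(** The witness is the value of [f] at the head of [s]; its sign passes from neighbour to neighbour,
    up to a square factor. *)
Lemma constant_sign s (f : R -> R) : {in s, forall x, f x != 0} ->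
  (forall i, (i.+1 < size s)%N -> 0 < f s`_i * f s`_i.+1) ->
  exists e : R, {in s, forall x, 0 < e * f x}.
Proof.
move=> f0 fs; exists (f s`_0) => _ /(nthP 0)[i + <-].
elim: i => [|i IHi] si; first by rewrite -expr2 exprn_even_gt0 //= f0 ?mem_nth.
have := mulr_gt0 (IHi (ltnW si)) (fs _ si).
have -> : f s`_0 * f s`_i * (f s`_i * f s`_i.+1) =
  f s`_i ^+ 2 * (f s`_0 * f s`_i.+1) by ring.
by rewrite pmulr_rgt0 // exprn_even_gt0 //= f0 ?mem_nth // ltnW.
Qed.

(** From one zero of [q] to the next, [q'] changes sign (the zeros are simple) and so does [p]
    (exactly one zero in between). Hence [p / q'] does not, and [e] carries the common sign. *)
Lemma interlace_residues p q : interlace p q ->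
  exists s (e : R), [/\ uniq s, size q = (size s).+1,
      forall x, root q x = (x \in s)
    & {in s, forall x, 0 < e * (p.[x] / q^`().[x])}].
Proof.
case=> -[rp rq] [sp sq] disj _ pq.
have [s s_le qE] := real_rooted_split rq.
have q0 := real_rooted_neq0 rq; have p0 := real_rooted_neq0 rp.
have l0 : lead_coef q != 0 by rewrite lead_coef_eq0.
have rs x : root q x = (x \in s).
  by rewrite qE rootZ // root_prod_XsubC.
have us : uniq s.
  apply: count_mem_uniq => x; case: (boolP (x \in s)) => [xs|/count_memPn//].
  have := sq x; rewrite rs xs => /(_ isT).
  by rewrite {1}qE -mul_polyC mupMr ?rootC // mu_prod_XsubC.
have s_lt : sorted <%R s by rewrite lt_sorted_uniq_le us.
have dq x : x \in s -> q^`().[x] != 0.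
  by rewrite -rs; apply: (simple_zerosP q0).1.
have npx x : x \in s -> ~~ root p x.
  by rewrite -rs => qx; have := disj x; rewrite [root q x]qx andbT.
have [e e_gt0] : exists e : R, {in s, forall x, 0 < e * (p.[x] / q^`().[x])}.
  apply: constant_sign => [x xs|i si].
    by rewrite mulf_neq0 ?invr_eq0 ?dq //; apply: npx.
  have [si0 si1] := (mem_nth 0 (ltnW si), mem_nth 0 si).
  have lt_i : s`_i < s`_i.+1 by rewrite (lt_sorted_ltn_nth 0) ?inE ?(ltnW si).
  have cz : consecutive_zeros q s`_i s`_i.+1.
    split=> //; first by have := si0; rewrite -rs.
      by have := si1; rewrite -rs.
    move=> t tt; apply/negP => qt; have : t \in s by rewrite -rs.
    case/(nthP 0) => j sj tE; move: tt; rewrite -tE.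
    rewrite !(lt_sorted_ltn_nth 0) ?inE ?(ltnW si) //.
    by rewrite ltnS [(j <= i)%N]leqNgt andbN.
  have dd := deriv_consecutive_zeros cz (dq _ si0) (dq _ si1).
  have pp := simple_zero_sign_change p0 sp lt_i (npx _ si0) (npx _ si1) (pq _ _ cz).
  by rewrite mulrACA -invfM nmulr_rgt0 // invr_lt0.
exists s, e; split=> //.
by rewrite qE size_scale // size_prod_XsubC.
Qed.

(** Lagrange interpolation: at [x] the cofactor of [X - x] in [q] has value [q'(x)], and it vanishes
    at the other points of [s]. Both sides agree on [s], which is too many points for the size of
    their difference. *)
Lemma partial_fractions p q s : uniq s -> (size q <= (size s).+1)%N ->
    {in s, forall x, root q x /\ q^`().[x] != 0} -> (size p <= size s)%N ->
  p = \sum_(x <- s) (p.[x] / q^`().[x]) *: (q %/ ('X - x%:P)).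
Proof.
move=> us sz_q qs sz_p; apply/subr0_eq; apply: (roots_geq_poly_eq0 _ us).
  apply/allP => y ys; have [qy dqy] := qs y ys.
  rewrite /root hornerD hornerN horner_sum (bigD1_seq y) //= big1_seq ?addr0.
    rewrite hornerZ; have : q^`().[y] = (q %/ ('X - y%:P)).[y].
      by rewrite -[in LHS](divpK (_ : 'X - y%:P %| q)) ?dvdp_XsubCl // mulrC
        deriv_XsubC_mul.
    by move=> <-; rewrite divfK // subrr.
  move=> x /andP[xy xs]; rewrite hornerZ; have [qx _] := qs x xs.
  have := qy; rewrite -[in root q y](divpK (_ : 'X - x%:P %| q)) ?dvdp_XsubCl //.
  rewrite rootM root_XsubC [y == x]eq_sym (negPf xy) orbF => /eqP ->.
  by rewrite mulr0.
rewrite (leq_trans (size_polyD _ _)) // size_polyN geq_max sz_p.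
rewrite (leq_trans (size_sum _ _ _)) //; apply/bigmax_leqP_seq => x _ _.
rewrite (leq_trans (size_scale_leq _ _)) // size_divp ?polyXsubC_eq0 //.
by rewrite size_XsubC leq_subLR add1n.
Qed.

(** * Wronskians without real zeros force interlacing *)

Definition wronskian p q := p^`() * q - p * q^`().

Lemma wronskianC p q : wronskian q p = - wronskian p q.
Proof. by rewrite /wronskian; ring. Qed.

Lemma consecutive_zero_between p x y : p != 0 -> root p x -> root p y -> x < y ->
  exists2 z, z <= y & consecutive_zeros p x z.
Proof.
move=> p0 px py xy; case: (next_rootP p x y) => [|z _ pz|c _ _ nr].
- by move/eqP; rewrite (negPf p0).
- rewrite in_itv /= => /andP[xz zy] nr; exists z; first exact: ltW.
  by split=> //; exact/rootP.
by exists y.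
Qed.

Section NonvanishingWronskian.
Variables p q : {poly R}.
Hypothesis W0 : forall x, ~~ root (wronskian p q) x.

Lemma wronskian_simple x : root p x -> p^`().[x] != 0 /\ ~~ root q x.
Proof.
move=> /rootP px; have := W0 x; rewrite /root /wronskian !hornerE px mul0r subr0.
by rewrite mulf_eq0 negb_or => /andP[].
Qed.

(** The Wronskian keeps its sign and reduces to [p' q] at both ends; since [p'] changes sign, so
    does [q]. *)
Lemma wronskian_zero_between x y : consecutive_zeros p x y ->
  exists2 t, x < t < y & root q t.
Proof.
move=> cz; have [px py xy _] := cz.
have [[dx _] [dy _]] := (wronskian_simple px, wronskian_simple py).
have dd := deriv_consecutive_zeros cz dx dy.
have : 0 < (wronskian p q).[x] * (wronskian p q).[y].
  by apply: (@noroot_noivt _ _ x y) => [t _||]; rewrite ?W0 // in_itv /= lexx ltW.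
rewrite /wronskian !hornerE (rootP px) (rootP py) !mul0r !subr0 mulrACA.
rewrite nmulr_rgt0 // => qq; have [t] := poly_ivtoo (ltW xy) qq.
by rewrite in_itv; exists t.
Qed.

End NonvanishingWronskian.

Lemma wronskian_one_zero_between p q : p != 0 -> q != 0 ->
  (forall x, ~~ root (wronskian p q) x) -> one_zero_between_zeros p q.
Proof.
move=> p0 q0 W0 x y cz; have [_ _ _ nr] := cz.
have W0' t : ~~ root (wronskian q p) t by rewrite wronskianC rootN.
(* Uniqueness: two zeros of [q] inside would, with the roles of [p] and [q] exchanged, enclose a
   zero of [p] between [x] and [y]. *)
have lt_noroot t u : root q t -> root q u -> x < t -> u < y -> ~~ (t < u).
  move=> qt qu xt uy; apply/negP => tu.
  have [z zu qz] := consecutive_zero_between q0 qt qu tu.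
  have [v /andP[tv vz] pv] := wronskian_zero_between W0' qz.
  have := nr v; rewrite pv (lt_trans xt tv) (lt_trans vz) ?(le_lt_trans zu) //.
  by move/(_ isT).
have [t xty qt] := wronskian_zero_between W0 cz; exists t; split=> // u [xuy qu].
have [/andP[xt ty] /andP[xu uy]] := (xty, xuy).
by case: (ltgtP t u) (lt_noroot t u qt qu xt uy) (lt_noroot u t qu qt xu ty).
Qed.

Lemma wronskian_interlace p q : real_rooted p -> real_rooted q ->
  (forall x, ~~ root (wronskian p q) x) -> interlace p q.
Proof.
move=> rp rq W0; have [p0 q0] := (real_rooted_neq0 rp, real_rooted_neq0 rq).
have W0' t : ~~ root (wronskian q p) t by rewrite wronskianC rootN.
split=> //; [split | | |]; try exact: wronskian_one_zero_between.
- by apply/(simple_zerosP p0) => x /(wronskian_simple W0)[].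
- by apply/(simple_zerosP q0) => x /(wronskian_simple W0')[].
by move=> x; apply/negP => /andP[/(wronskian_simple W0)[_ /negPf->]].
Qed.

(** * The pencil [p + a q] of an interlacing pair *)

Section Pencil.
Variables p q : {poly R}.
Hypotheses (pq : interlace p q) (sz_pq : (size p < size q)%N).

(** Here [c x] is the residue of [p / q] at [x] and [h x] is [q / (X - x)]. This form serves two
    positivity arguments, one at real points and one off the real line. *)
Lemma interlace_decomposition : exists s (e : R) (c : R -> R) (h : R -> {poly R}),
  [/\ s != [::], {in s, forall x, 0 < e * c x},
      {in s, forall x, q = ('X - x%:P) * h x},
      forall x, root q x -> exists2 y, y \in s & (h y).[x] != 0
    & p = \sum_(x <- s) c x *: h x].
Proof.
have [s [e [us sz_q rs e_gt0]]] := interlace_residues pq.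
have [[rp rq] [_ sq] _ _ _] := pq.
have dq x : root q x -> q^`().[x] != 0.
  exact: (simple_zerosP (real_rooted_neq0 rq)).1.
have qE : {in s, forall x, q = ('X - x%:P) * (q %/ ('X - x%:P))}.
  by move=> x; rewrite -rs => qx; rewrite mulrC divpK // dvdp_XsubCl.
exists s, e, (fun x => p.[x] / q^`().[x]), (fun x => q %/ ('X - x%:P)).
split=> //.
(* If [q] were constant, the size bound would force [p = 0]. *)
- apply: contraTneq sz_pq => s0; rewrite sz_q s0 ltnS -ltnNge lt0n size_poly_eq0.
  exact: real_rooted_neq0.
- move=> x qx; exists x; first by rewrite -rs.
  by rewrite -(deriv_XsubC_mul _ x) -qE -?rs // dq.
apply: partial_fractions => //; first by rewrite sz_q.
  by move=> x; rewrite -rs => qx; rewrite qx dq.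
by rewrite -ltnS -sz_q.
Qed.

Lemma wronskian_neq0 x : ~~ root (wronskian p q) x.
Proof.
have [s [e [c [h [s0 e_gt0 qE h_neq0 pE]]]]] := interlace_decomposition.
have WE : wronskian p q = - \sum_(y <- s) c y *: h y ^+ 2.
  rewrite /wronskian pE linear_sum /= !mulr_suml -sumrB -sumrN.
  apply: eq_big_seq => y ys; rewrite derivZ [in LHS](qE y ys) derivM derivXsubC.
  by rewrite -!mul_polyC; ring.
(* After scaling by [e] all terms are nonnegative, so every [h y] vanishes at [x]. Then [x] is a
   zero of [q], where some [h y] is nonzero. *)
apply/negP; rewrite WE rootN => /rootP W0.
have hx0 : {in s, forall y, (h y).[x] = 0}.
  have /eqP : \sum_(y <- s | y \in s) e * c y * (h y).[x] ^+ 2 = 0.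
    rewrite -big_seq -[RHS](mulr0 e) -[in RHS]W0 horner_sum mulr_sumr.
    by apply: eq_bigr => y _; rewrite hornerZ horner_exp -mulrA.
  rewrite psumr_eq0 => [|y ys]; last by rewrite mulr_ge0 ?sqr_ge0 // ltW ?e_gt0.
  move/allP => hs y ys; have := hs y ys; rewrite ys /= mulf_eq0 gt_eqF ?e_gt0 //=.
  by rewrite sqrf_eq0 => /eqP.
have qx : root q x.
  case: s s0 hx0 qE {e_gt0 h_neq0 pE WE W0} => // y s _ /(_ y (mem_head _ _)) hy.
  by move=> /(_ y (mem_head _ _)) ->; rewrite rootM /root hy eqxx orbT.
by have [y ys] := h_neq0 _ qx; rewrite hx0 ?eqxx.
Qed.

Lemma pencil_real_rooted (a : R) : real_rooted (p + a *: q).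
Proof.
move=> z; have [s [e [c [h [s0 e_gt0 qE _ pE]]]]] := interlace_decomposition.
rewrite CrealE; set P := complexify p; set Q := complexify q.
pose H y := complexify (h y).
have -> : complexify (p + a *: q) = P + a%:C *: Q.
  by rewrite /complexify rmorphD /= map_polyZ.
have QE : {in s, forall y, Q.[z] = (z - y%:C) * (H y).[z]}.
  move=> y ys; rewrite /Q {1}(qE y ys) /complexify rmorphM /= map_polyXsubC.
  by rewrite hornerM hornerXsubC.
have PE : P.[z] = \sum_(y <- s) (c y)%:C * (H y).[z].
  rewrite /P pE /complexify rmorph_sum horner_sum; apply: eq_bigr => y _.
  by rewrite /= map_polyZ hornerZ.
rewrite /root hornerD hornerZ addr_eq0 => /eqP PQ.
apply/contraT => z_nreal.
have conjR (x : R) : Num.conj x%:C = x%:C by apply: conj_Creal; rewrite complex_real.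
(* Twice [i] times the imaginary part of [P] times the conjugate of [Q], which stands in for [P / Q]
   without dividing by [Q]. *)
have Sz : P.[z] * Num.conj Q.[z] - Num.conj (P.[z] * Num.conj Q.[z]) =
    (Num.conj z - z) * \sum_(y <- s) (c y)%:C * `|(H y).[z]| ^+ 2.
  rewrite PE !rmorphM !rmorph_sum /= !mulr_suml -sumrB mulr_sumr.
  apply: eq_big_seq => y ys; rewrite conjCK normCK !rmorphM /= conjR (QE y ys).
  rewrite rmorphM rmorphB /= conjR; ring.
have /eqP : \sum_(y <- s | y \in s) (e * c y)%:C * `|(H y).[z]| ^+ 2 = 0.
  (* At a zero of the pencil the product is [- a |Q(z)|^2], which is real. *)
  have : (Num.conj z - z) * \sum_(y <- s) (c y)%:C * `|(H y).[z]| ^+ 2 == 0.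
    by rewrite -Sz PQ !(rmorphM, rmorphN) /= conjCK conjR subr_eq0; apply/eqP; ring.
  rewrite mulf_eq0 subr_eq0 (negPf z_nreal) /= => /eqP S0.
  rewrite -big_seq -[RHS](mulr0 e%:C) -[in RHS]S0 mulr_sumr.
  by apply: eq_bigr => y _; rewrite rmorphM -mulrA.
rewrite psumr_eq0 => [|y ys]; last first.
  by rewrite mulr_ge0 ?exprn_ge0 // ler0c ltW ?e_gt0.
move/allP => hs.
(* As [s] is nonempty, one vanishing [H y] suffices; then [z] is real because [q] is real-rooted. *)
have Qz : root Q z.
  case: s s0 hs e_gt0 QE {qE pE PE Sz} => // y s _ hs e_gt0 QE.
  have ys := mem_head y s; have := hs y ys.
  rewrite ys mulf_eq0 sqrf_eq0 normr_eq0 /root (QE y ys).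
  rewrite gt_eqF /= => [/eqP->|]; first by rewrite mulr0.
  by rewrite ltcR e_gt0.
have [[_ rq] _ _ _ _] := pq; have := rq z Qz.
by rewrite CrealE (negPf z_nreal).
Qed.

Lemma interlace_pencil (a : R) : a != 0 ->
  [/\ real_rooted (p + a *: q), interlace (p + a *: q) q
    & interlace (p + a *: q) p].
Proof.
move=> a0; have rpq := @pencil_real_rooted a; have [[rp rq] _ _ _ _] := pq.
split=> //; apply: wronskian_interlace => // x.
  have -> : wronskian (p + a *: q) q = wronskian p q.
    by rewrite /wronskian derivD derivZ -!mul_polyC; ring.
  exact: wronskian_neq0.
have -> : wronskian (p + a *: q) p = - (a *: wronskian p q).
  by rewrite /wronskian derivD derivZ -!mul_polyC; ring.
by rewrite rootN rootZ // wronskian_neq0.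
Qed.

End Pencil.

End Interlacing.

(** * Type I vectors: degrees and the connection formula *)

Section TypeILinearAlgebra.
Variables (R : realType) (s : nat).
Implicit Types (nu : fsystem R s) (k : multi_index s) (j : 'I_s).
Implicit Types (A B : {ffun 'I_s -> {poly R[i]}}).

Lemma in_L_inj (mu : moment_functional R) N M : in_L N mu -> in_L M mu -> N = M.
Proof.
have lt_absurd m n : in_L (Some m) mu -> in_L (Some n) mu -> (m < n)%N -> False.
  move=> [_ _ zm] [_ zn _] mn.
  by have := zn n; rewrite zm // eqxx leqnn (leq_ltn_trans _ mn) // => /(_ isT).
have oo_absurd m : in_L (Some m) mu -> in_L None mu -> False.
  by move=> [_ _ zm] /(_ m.+1 isT); rewrite zm ?eqxx.
case: N M => [n|] [m|] // nN nM.
- by case: (ltngtP n m) (lt_absurd n m nN nM) (lt_absurd m n nM nN)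
    => [_ /(_ isT)|_ _ /(_ isT)|->].
- by case: (oo_absurd n).
by case: (oo_absurd m).
Qed.

(** [perfect] hides its bounds behind an existential; [in_L_inj] identifies them with [K]. *)
Lemma perfect_normal nu K k :
  (forall i, in_L (K i) (nu i)) -> perfect nu -> in_box K k -> normal nu k.
Proof.
move=> hK [N [hN nN]] hk; apply: nN => i.
by rewrite (in_L_inj (hN i) (hK i)); apply: hk.
Qed.

Lemma midx_size_pred k j : (0 < k j)%N ->
  midx_size k = (midx_size (midx_pred k j)).+1.
Proof.
move=> kj; rewrite /midx_size (bigD1 j) //= [in RHS](bigD1 j) //= ffunE eqxx.
rewrite -addSn subn1 prednK //; congr (_ + _)%N.
by apply: eq_bigr => i /negPf ij; rewrite ffunE ij subn0.
Qed.

(** Adding a homogeneous solution [B] to [A] gives another type I vector, so uniqueness kills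
    [B]. *)
Lemma typeI_kernel nu k A B : is_typeI nu k A ->
    (forall i, (size (B i) <= k i)%N) ->
    (forall p, (p < midx_size k)%N -> \sum_i nu i (B i * 'X^p) = 0) ->
  B = 0.
Proof.
case=> -[sA mA] uA sB mB; apply: (addrI A); rewrite addr0; apply/esym/uA; split.
  by move=> i; rewrite ffunE (leq_trans (size_polyD _ _)) // geq_max sA sB.
move=> k0; have [mA0 mA1] := mA k0.
have mAB p : (p < midx_size k)%N ->
    \sum_i nu i ((A + B) i * 'X^p) = \sum_i nu i (A i * 'X^p).
  move=> pk; rewrite -[RHS]addr0 -[X in _ = _ + X](mB p pk) -big_split /=.
  by apply: eq_bigr => i _; rewrite ffunE mulrDl linearD.
by split=> [p pk|]; rewrite mAB ?prednK // ?mA0 // ltnW.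
Qed.

(** If the degree dropped, [A] would solve the homogeneous problem at [k - e_j], hence vanish,
    against its normalisation. *)
Lemma typeI_size nu k j A B : (0 < k j)%N ->
  is_typeI nu k A -> is_typeI nu (midx_pred k j) B -> size (A j) = k j.
Proof.
move=> kj [[sA mA] _] hB; apply/eqP; rewrite eqn_leq sA leqNgt; apply/negP => lt_j.
have sz := midx_size_pred kj; have [mA0 mA1] := mA (ltac:(by rewrite sz)).
suff A0 : A = 0.
  move: mA1; rewrite A0 big1 => [/esym/eqP|i _]; first by rewrite oner_eq0.
  by rewrite ffunE mul0r linear0.
apply: (typeI_kernel hB) => [i|p lt_p]; last by apply: mA0; rewrite sz.
rewrite ffunE; case: eqP => [->|_]; last by rewrite subn0.
by rewrite subn1 -ltnS prednK.
Qed.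

Lemma typeI_christoffel nu z0 k j A Ahat Ahat_pred :
    (0 < k j)%N -> (1 < midx_size k)%N ->
    is_typeI nu k A -> is_typeI (christoffel_system z0 nu) k Ahat ->
    is_typeI (christoffel_system z0 nu) (midx_pred k j) Ahat_pred ->
  exists c, forall i, A i = Ahat_pred i + c *: Ahat i.
Proof.
move=> kj k1 [[sA mA] _] hAhat [[sP mP] _].
have sz := midx_size_pred kj; set m := midx_size (midx_pred k j) in sz mP.
have [[sH mH] _] := hAhat.
(* The index 0 carries no normalisation, so [k = e_j] has to be excluded. *)
have m0 : (0 < m)%N by rewrite -ltnS -sz.
rewrite sz in mA mH; have [mA0 mA1] := mA isT; have [mH0 mH1] := mH isT.
have [mP0 mP1] := mP m0; rewrite /= in mA1 mH1.
pose mom (B : {ffun 'I_s -> {poly R[i]}}) p :=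
  \sum_i christoffel_system z0 nu i (B i * 'X^p).
have momB B C p : mom (B - C) p = mom B p - mom C p.
  rewrite /mom -sumrB; apply: eq_bigr => i _.
  by rewrite !ffunE mulrBl linearB.
have momA p : mom A p = \sum_i nu i (A i * 'X^(p.+1))
    - z0%:C * \sum_i nu i (A i * 'X^p).
  rewrite /mom mulr_sumr -sumrB; apply: eq_bigr => i _.
  rewrite /christoffel_system /= /christoffel mulrBl linearB exprS; congr (_ - _).
    by rewrite mulrCA.
  by rewrite mul_polyC linearZ.
pose D := A - Ahat_pred; pose c := mom D m; exists c.
suff E0 : D - [ffun i => c *: Ahat i] = 0.
  move=> i; move/ffunP/(_ i): E0; rewrite !ffunE => /eqP.
  by rewrite subr_eq0 subr_eq addrC => /eqP.
apply: (typeI_kernel hAhat) => [i|p].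
  rewrite !ffunE (leq_trans (size_polyD _ _)) // size_polyN geq_max.
  rewrite (leq_trans (size_scale_leq _ _)) ?sH // andbT.
  rewrite (leq_trans (size_polyD _ _)) // size_polyN geq_max sA /=.
  by rewrite (leq_trans (sP i)) // ffunE leq_subr.
rewrite -/(mom _ p) momB.
have -> : mom [ffun i => c *: Ahat i] p = c * mom Ahat p.
  rewrite /mom mulr_sumr; apply: eq_bigr => i _.
  by rewrite ffunE -scalerAl linearZ.
(* At [p = m] the choice of [c] cancels the moment, since that of [Ahat] is 1. *)
rewrite sz ltnS leq_eqVlt => /orP[/eqP->|pm].
  by rewrite [mom Ahat _]mH1 mulr1 subrr.
rewrite [mom Ahat _]mH0 // mulr0 subr0 momB momA [X in z0%:C * X]mA0 // mulr0 subr0.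
(* At [p = m - 1] both moments are 1: the factor [X] shifts that of [A] to its normalisation at
   [m = |k| - 1]. *)
move: pm; rewrite -[in (p < m)%N](prednK m0) ltnS leq_eqVlt => /orP[/eqP->|pm].
  by rewrite prednK // mA1 [mom Ahat_pred _]mP1 subrr.
have pm2 : (p.+2 <= m)%N by rewrite -(prednK m0) ltnS.
by rewrite mA0 // [mom Ahat_pred _]mP0 // subrr.
Qed.

End TypeILinearAlgebra.

(** The coefficient of [p - q] at the degree of [h] is [c] times the leading coefficient of [h], so
    [c] is a quotient of reals. *)
Lemma complexify_pencil (R : realType) (p q h : {poly R}) (c : R[i]) : h != 0 ->
  complexify p = complexify q + c *: complexify h -> exists a, p = q + a *: h.
Proof.
move=> h0 pE; set l := lead_coef h; have l0 : l != 0 by rewrite lead_coef_eq0.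
exists ((p - q)`_(size h).-1 / l).
apply: (@map_poly_inj _ _ (real_complex R)).
rewrite rmorphD /= map_polyZ -/(complexify p) -/(complexify q) pE; congr (_ + _ *: _).
have : (complexify p - complexify q)`_(size h).-1 = c * l%:C.
  by rewrite pE addrC addKr coefZ coef_map.
rewrite -rmorphB /= coef_map /= => pqE.
by rewrite rmorphM fmorphV /= [X in _ = X / _]pqE mulfK // fmorph_eq0.
Qed.

Theorem corollary3p25 (R : realType) (r : nat) (hr : (2 <= r)%N)
  (nu : fsystem R r.-1) (K : 'I_r.-1 -> option nat)
  (hK : forall i, in_L (K i) (nu i))
  (z0 : R)
  (hperf : perfect nu)
  (hperf_hat : perfect (christoffel_system z0 nu))
  (j : 'I_r.-1) (k : multi_index r.-1)
  (hkj : (0 < k j)%N) (hk : in_box K k) (hkpred : in_box K (midx_pred k j))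
  (A Ahat Ahat_pred : {ffun 'I_r.-1 -> {poly R[i]}})
  (hA : is_typeI nu k A)
  (hAhat : is_typeI (christoffel_system z0 nu) k Ahat)
  (hAhat_pred :
     is_typeI (christoffel_system z0 nu) (midx_pred k j) Ahat_pred)
  (p phat phat_pred : {poly R})
  (hp : A j = complexify p)
  (hphat : Ahat j = complexify phat)
  (hphat_pred : Ahat_pred j = complexify phat_pred) :
  interlace phat_pred phat ->
  [/\ real_rooted p, interlace p phat & interlace p phat_pred].
Proof.
move=> ilace; have [[r_pred r_hat] _ _ _ _] := ilace.
have size_c (q : {poly R}) : size (complexify q) = size q by apply: size_map_poly.
have sz_p : size p = k j.
  have [B hB] := perfect_normal hK hperf hkpred.
  by rewrite -size_c -hp (typeI_size hkj hA hB).
have sz_pred : (size phat_pred < k j)%N.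
  have [[/(_ j) + _] _] := hAhat_pred.
  by rewrite hphat_pred size_c ffunE eqxx subn1 -ltnS prednK.
(* [phat_pred] is nonzero of size below [k j], so [k j] is at least 2. *)
have k1 : (1 < midx_size k)%N.
  rewrite (leq_ltn_trans _ (leq_trans sz_pred _)) //.
    by rewrite size_poly_gt0 real_rooted_neq0.
  by rewrite /midx_size (bigD1 j) //= leq_addr.
have [c AE] := typeI_christoffel hkj k1 hA hAhat hAhat_pred.
have := AE j; rewrite hp hphat hphat_pred.
case/(complexify_pencil (real_rooted_neq0 r_hat)) => a pE.
(* Otherwise [p = phat_pred], although their sizes differ. *)
have a0 : a != 0.
  by apply: contraTneq sz_pred => a0; rewrite -sz_p pE a0 scale0r addr0 ltnn.
have sz_hat : size phat = k j.
  have -> : phat = a^-1 *: (p - phat_pred) by rewrite pE addrC addKr scalerK.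
  by rewrite size_scale ?invr_eq0 // size_polyDl ?size_polyN sz_p.
by rewrite pE; apply: interlace_pencil; rewrite ?sz_hat.
Qed.
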